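(* Let $\theta, a:\mathbb{R}\to\mathbb{R}$ be $C^\infty$ functions, let $b:\mathbb{R}\to\mathbb{R}$ be a $C^\infty$ function, and suppose that the mapping $$f(t)=a(t)\left(\cos\theta(t),\sin\theta(t)\right)+b(t)\left(-\sin\theta(t),\cos\theta(t)\right)$$ is an envelope created by the straight line family $\{L_{(\theta(t),a(t))}\}_{t\in\mathbb{R}}$. Then the mapping $g:\mathbb{R}\to\mathbb{R}^2$ defined by $$g(t)=\left(b(t)\theta(t)-a(t)\right)\left(\cos b(t),\sin b(t)\right)+\theta(t)\left(-\sin b(t),\cos b(t)\right)$$ is an envelope created by the straight line family $\{L_{(b(t),\,b(t)\theta(t)-a(t))}\}_{t\in\mathbb{R}}$.
   Context: For $C^\infty$ functions $\vartheta,\alpha:\mathbb{R}\to\mathbb{R}$, the straight line family $\{L_{(\vartheta(t),\alpha(t))}\}_{t\in\mathbb{R}}$ consists of the lines $L_{(\vartheta(t),\alpha(t))}=\{(X,Y)\in\mathbb{R}^2 \mid X\cos\vartheta(t)+Y\sin\vartheta(t)=\alpha(t)\}$. Its Gauss mapping is $\nu:\mathbb{R}\to S^1$, $\nu(t)=(\cos\vartheta(t),\sin\vartheta(t))$. An envelope created by this family is a $C^\infty$ mapping $h:\mathbb{R}\to\mathbb{R}^2$ such that for every $t\in\mathbb{R}$: (a) $\frac{dh}{dt}(t)\cdot\nu(t)=0$ (standard scalar product), and (b) $h(t)\in L_{(\vartheta(t),\alpha(t))}$. *)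

(* Defs.v *)
From Stdlib Require Import Reals.
From Coquelicot Require Import Coquelicot.
Open Scope R_scope.

Definition smooth (f : R -> R) : Prop :=
  forall (n : nat) (t : R), ex_derive_n f n t.

(* The plane is [R * R]; smoothness and derivative of a plane curve are taken
   coordinatewise. *)
Definition smooth_curve (h : R -> R * R) : Prop :=
  smooth (fun t => fst (h t)) /\ smooth (fun t => snd (h t)).

(* [Derive] is a total operator: [velocity h t] is the derivative of [h] only
   where both coordinates are differentiable. *)
Definition velocity (h : R -> R * R) (t : R) : R * R :=
  (Derive (fun s => fst (h s)) t, Derive (fun s => snd (h s)) t).

Definition dot (u v : R * R) : R := fst u * fst v + snd u * snd v.

Definition line (theta alpha : R) (p : R * R) : Prop :=
  fst p * cos theta + snd p * sin theta = alpha.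

Definition gauss (theta : R -> R) (t : R) : R * R :=
  (cos (theta t), sin (theta t)).

(* Smoothness of [theta] and [alpha] themselves is not bundled here; it is a
   standing assumption on the line family. *)
Definition is_envelope (theta alpha : R -> R) (h : R -> R * R) : Prop :=
  smooth_curve h /\
  forall t : R,
    dot (velocity h t) (gauss theta t) = 0 /\
    line (theta t) (alpha t) (h t).

(* x (cos phi, sin phi) + y (- sin phi, cos phi) *)
Definition in_frame (phi x y : R) : R * R :=
  (x * cos phi + y * - sin phi, x * sin phi + y * cos phi).

(* Main.v *)
Require Import Defs.
From Stdlib Require Import Reals Lia Lra.
From Coquelicot Require Import Coquelicot.
Open Scope R_scope.

(** Write a plane curve in the moving frame [nu = (cos phi, sin phi)],
    [mu = (- sin phi, cos phi)] as [x nu + y mu].  Since [nu' = phi' mu] and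
    [mu' = - phi' nu], the [nu]-component of its velocity is [x' - y phi']
    ([normal_velocity_in_frame]), and its scalar product with [nu] is [x], so
    it meets the lines [L_(phi, x)] automatically.  Hence the smooth curve
    [x nu + y mu] is an envelope of the lines [L_(phi, x)] exactly when
    [x' = y phi'] ([is_envelope_in_frame]).

    The hypothesis therefore says [a' = b theta'], and the conclusion says
    [(b theta - a)' = theta b'].  By the product rule these are the same
    equation: passing from [(theta, a, b)] to [(b, b theta - a, theta)] is the
    Legendre transformation, which preserves the contact relation
    [da = b dtheta].

    What remains is that smooth functions are stable under sums, products,
    sine and cosine.  The Leibniz and chain rules express the derivative
    of such a combination through functions of the same kind, so finite orders
    of differentiability are treated by induction. *)

(** * Finite orders of differentiability *)

(** Smoothness by itself offers no induction; a bounded order does, through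
    [diff_upto_S]. *)
Definition diff_upto (n : nat) (f : R -> R) : Prop :=
  forall k t, (k <= n)%nat -> ex_derive_n f k t.

Lemma smooth_diff_upto (f : R -> R) :
  smooth f <-> forall n, diff_upto n f.
Proof.
split.
- intros H n k t _; apply H.
- intros H n t; exact (H n n t (le_n n)).
Qed.

Lemma diff_upto_le (m n : nat) (f : R -> R) :
  (m <= n)%nat -> diff_upto n f -> diff_upto m f.
Proof. intros Hmn H k t Hk; apply H; lia. Qed.

Lemma diff_upto_ext (n : nat) (f g : R -> R) :
  (forall t, f t = g t) -> diff_upto n f -> diff_upto n g.
Proof.
intros E H k t Hk; apply ex_derive_n_ext with f; [exact E | now apply H].
Qed.

Lemma ex_derive_n_Derive (f : R -> R) (k : nat) (t : R) :
  ex_derive_n (Derive f) (S k) t <-> ex_derive_n f (S (S k)) t.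
Proof.
assert (E : forall s, Derive_n (Derive f) k s = Derive_n f (S k) s).
{ intros s; replace (S k) with (k + 1)%nat by lia.
  exact (Derive_n_comp f k 1 s). }
split; intros H; simpl; refine (ex_derive_ext _ _ _ _ H); intros s.
- exact (E s).
- symmetry; exact (E s).
Qed.

(** The derivative is taken innermost here, so that Leibniz and chain rules
    apply to it, whereas [ex_derive_n] differentiates outermost. *)
Lemma diff_upto_S (n : nat) (f : R -> R) :
  diff_upto (S n) f <-> (forall t : R, ex_derive f t) /\ diff_upto n (Derive f).
Proof.
split.
- intros H; split.
  + intros t; apply (H 1%nat t); lia.
  + intros [|k] t Hk; [exact I |].
    apply (proj2 (ex_derive_n_Derive f k t)), H; lia.
- intros [H1 H] [|[|k]] t Hk; [exact I | exact (H1 t) |].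
  apply (proj1 (ex_derive_n_Derive f k t)), H; lia.
Qed.

Lemma diff_upto_plus (n : nat) (f g : R -> R) :
  diff_upto n f -> diff_upto n g -> diff_upto n (fun t => f t + g t).
Proof.
revert f g; induction n as [|n IH]; intros f g Hf Hg.
- intros k t Hk; replace k with 0%nat by lia; exact I.
- apply diff_upto_S in Hf; destruct Hf as [Df Hf].
  apply diff_upto_S in Hg; destruct Hg as [Dg Hg].
  apply diff_upto_S; split.
  + intros t; apply (ex_derive_plus f g); auto.
  + apply diff_upto_ext with (fun t => Derive f t + Derive g t).
    * intros t; symmetry; apply Derive_plus; auto.
    * now apply IH.
Qed.

Lemma diff_upto_opp (n : nat) (f : R -> R) :
  diff_upto n f -> diff_upto n (fun t => - f t).
Proof. intros H k t Hk; apply ex_derive_n_opp; now apply H. Qed.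

(** By the Leibniz rule [(f g)' = f' g + f g'], order [n + 1] of a product
    follows from order [n] of two products. *)
Lemma diff_upto_mult (n : nat) (f g : R -> R) :
  diff_upto n f -> diff_upto n g -> diff_upto n (fun t => f t * g t).
Proof.
revert f g; induction n as [|n IH]; intros f g Hf Hg.
- intros k t Hk; replace k with 0%nat by lia; exact I.
- assert (Hf' := diff_upto_le n (S n) f (le_S _ _ (le_n n)) Hf).
  assert (Hg' := diff_upto_le n (S n) g (le_S _ _ (le_n n)) Hg).
  apply diff_upto_S in Hf; destruct Hf as [Df Hf].
  apply diff_upto_S in Hg; destruct Hg as [Dg Hg].
  apply diff_upto_S; split.
  + intros t; apply ex_derive_mult; auto.
  + apply diff_upto_ext with (fun t => Derive f t * g t + f t * Derive g t).
    * intros t; symmetry; apply Derive_mult; auto.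
    * apply diff_upto_plus; now apply IH.
Qed.

(** Each of the two functions occurs in the derivative of the other, whence
    the joint induction. *)
Lemma diff_upto_cos_sin (n : nat) (f : R -> R) :
  diff_upto n f ->
  diff_upto n (fun t => cos (f t)) /\ diff_upto n (fun t => sin (f t)).
Proof.
induction n as [|n IH]; intros Hf.
- split; intros k t Hk; replace k with 0%nat by lia; exact I.
- destruct (IH (diff_upto_le n (S n) f (le_S _ _ (le_n n)) Hf)) as [Hc Hs].
  apply diff_upto_S in Hf; destruct Hf as [Df Hf].
  split; apply diff_upto_S; split.
  + intros t; auto_derive; auto.
  + apply diff_upto_ext with (fun t => Derive f t * - sin (f t)).
    * intros t; symmetry; apply is_derive_unique; auto_derive; [auto |].
      change (Derive (fun s => f s) t) with (Derive f t); ring.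
    * apply diff_upto_mult; [exact Hf | now apply diff_upto_opp].
  + intros t; auto_derive; auto.
  + apply diff_upto_ext with (fun t => Derive f t * cos (f t)).
    * intros t; symmetry; apply is_derive_unique; auto_derive; [auto |].
      change (Derive (fun s => f s) t) with (Derive f t); ring.
    * now apply diff_upto_mult.
Qed.

(** * Smooth functions and smooth curves in a moving frame *)

Lemma smooth_ex_derive (f : R -> R) (t : R) : smooth f -> ex_derive f t.
Proof. intros H; exact (H 1%nat t). Qed.

Lemma smooth_plus (f g : R -> R) :
  smooth f -> smooth g -> smooth (fun t => f t + g t).
Proof.
rewrite !smooth_diff_upto; intros Hf Hg n; now apply diff_upto_plus.
Qed.

Lemma smooth_opp (f : R -> R) : smooth f -> smooth (fun t => - f t).
Proof. rewrite !smooth_diff_upto; intros Hf n; now apply diff_upto_opp. Qed.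

Lemma smooth_mult (f g : R -> R) :
  smooth f -> smooth g -> smooth (fun t => f t * g t).
Proof.
rewrite !smooth_diff_upto; intros Hf Hg n; now apply diff_upto_mult.
Qed.

Lemma smooth_cos (f : R -> R) : smooth f -> smooth (fun t => cos (f t)).
Proof.
rewrite !smooth_diff_upto; intros Hf n.
exact (proj1 (diff_upto_cos_sin n f (Hf n))).
Qed.

Lemma smooth_sin (f : R -> R) : smooth f -> smooth (fun t => sin (f t)).
Proof.
rewrite !smooth_diff_upto; intros Hf n.
exact (proj2 (diff_upto_cos_sin n f (Hf n))).
Qed.

Lemma smooth_curve_in_frame (phi x y : R -> R) :
  smooth phi -> smooth x -> smooth y ->
  smooth_curve (fun t => in_frame (phi t) (x t) (y t)).
Proof.
intros Hphi Hx Hy.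
assert (Hc := smooth_cos phi Hphi); assert (Hs := smooth_sin phi Hphi).
split; simpl.
- apply smooth_plus; apply smooth_mult; auto; now apply smooth_opp.
- apply smooth_plus; now apply smooth_mult.
Qed.

(** * Envelopes in a moving frame *)

Lemma line_in_frame (phi x y : R) : line phi x (in_frame phi x y).
Proof.
unfold line, in_frame; simpl.
transitivity (x * (Rsqr (sin phi) + Rsqr (cos phi))).
- unfold Rsqr; ring.
- rewrite sin2_cos2; ring.
Qed.

(** Since [nu' = phi' mu] and [mu' = - phi' nu], only [x'] and the turning of
    [mu] contribute along the normal. *)
Lemma normal_velocity_in_frame (phi x y : R -> R) (t : R) :
  ex_derive phi t -> ex_derive x t -> ex_derive y t ->
  dot (velocity (fun s => in_frame (phi s) (x s) (y s)) t) (gauss phi t) =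
  Derive x t - y t * Derive phi t.
Proof.
intros Hphi Hx Hy; unfold dot, velocity, gauss, in_frame; simpl.
transitivity ((Derive x t - y t * Derive phi t) *
              (Rsqr (sin (phi t)) + Rsqr (cos (phi t)))).
2: rewrite sin2_cos2; ring.
erewrite (is_derive_unique (fun s => x s * cos (phi s) + y s * - sin (phi s)));
  [| auto_derive; [auto | reflexivity]].
erewrite (is_derive_unique (fun s => x s * sin (phi s) + y s * cos (phi s)));
  [| auto_derive; [auto | reflexivity]].
change (Derive (fun s => phi s) t) with (Derive phi t).
change (Derive (fun s => x s) t) with (Derive x t).
change (Derive (fun s => y s) t) with (Derive y t).
unfold Rsqr; ring.
Qed.

(** The incidence with the lines holds for every [y], so tangency is the only
    condition: the triple [(phi, x, y)] is an integral curve of the contact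
    form [dx - y dphi]. *)
Lemma is_envelope_in_frame (phi x y : R -> R) :
  smooth phi -> smooth x -> smooth y ->
  is_envelope phi x (fun t => in_frame (phi t) (x t) (y t)) <->
  (forall t, Derive x t = y t * Derive phi t).
Proof.
intros Hphi Hx Hy.
assert (V := fun t => normal_velocity_in_frame phi x y t
  (smooth_ex_derive phi t Hphi) (smooth_ex_derive x t Hx)
  (smooth_ex_derive y t Hy)).
split.
- intros [_ H] t; destruct (H t) as [Ht _]; rewrite V in Ht; lra.
- intros H; split; [now apply smooth_curve_in_frame |].
  intros t; split; [rewrite V, H; ring | apply line_in_frame].
Qed.

Theorem corollary4 (theta a b : R -> R)
  (htheta : smooth theta) (ha : smooth a) (hb : smooth b)
  (hf : is_envelope theta a (fun t => in_frame (theta t) (a t) (b t))) :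
  is_envelope b (fun t => b t * theta t - a t)
    (fun t => in_frame (b t) (b t * theta t - a t) (theta t)).
Proof.
assert (contact := proj1 (is_envelope_in_frame theta a b htheta ha hb) hf).
assert (hx : smooth (fun t => b t * theta t - a t)).
{ apply smooth_plus; [now apply smooth_mult | now apply smooth_opp]. }
apply (proj2 (is_envelope_in_frame b _ theta hb hx htheta)).
intros t.
assert (Da := smooth_ex_derive a t ha).
assert (Db := smooth_ex_derive b t hb).
assert (Dtheta := smooth_ex_derive theta t htheta).
rewrite Derive_minus, Derive_mult, contact; auto; [ring |].
now apply ex_derive_mult.
Qed.
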